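(* Let $D=(V,A)$ be a finite simple digraph with $n=|V|\ge 1$. (i) $F(D)=n-1$ if and only if $D$ has a source. (ii) $F(D)=n-2$ if and only if there exist distinct $u,v\in V$ with $N_D^-(u)\setminus\{v\}=N_D^-(v)\setminus\{u\}$, and $\deg^-(w)>0$ for all $w\in V$. (iii) $F(D)=n-3$ if and only if all of the following conditions are satisfied: 1. $\deg^-(v)>0$ for all $v\in V$; 2. for any distinct vertices $u,v\in V$, $N_D^-(u)\setminus\{v\}\neq N_D^-(v)\setminus\{u\}$; 3. there exist distinct vertices $u,v,w\in V$ such that $N_D^-(u)\setminus\{v,w\}\subseteq N_D^-(v)\cup N_D^-(w)$, $N_D^-(v)\setminus\{u,w\}\subseteq N_D^-(u)\cup N_D^-(w)$, and $N_D^-(w)\setminus\{u,v\}\subseteq N_D^-(u)\cup N_D^-(v)$.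
   Context: A finite simple digraph $D=(V,A)$ has finite nonempty vertex set $V$ and arc set $A$ consisting of ordered pairs of distinct vertices (no loops, no parallel arcs; both $(u,v)$ and $(v,u)$ may be present). $N_D^+(v)=\{u:(v,u)\in A\}$ is the set of out-neighbors of $v$, $N_D^-(v)=\{u:(u,v)\in A\}$ the set of in-neighbors, and $\deg^{\pm}(v)=|N_D^{\pm}(v)|$. A source is a vertex $v$ with $\deg^-(v)=0$. Zero forcing: for $S\subseteq V$ let $B^0(S)=S$ and $B^{i+1}(S)=B^i(S)\cup\{w:\{w\}=N_D^+(v)\setminus B^i(S)\text{ for some }v\in B^i(S)\}$. $S$ is a zero forcing set (ZFS) if $B^t(S)=V$ for some $t\ge 0$, and a failed zero forcing set (FZFS) otherwise. The failed zero forcing number $F(D)$ is the largest cardinality of an FZFS of $D$. *)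

(* Defs.v *)
(* MathComp, with classical decidability ([`[< P >]]) from MathComp-Analysis. *)
From HB Require Import structures.
From mathcomp Require Import all_boot.
From mathcomp Require Import boolp.
Set Implicit Arguments.
Unset Strict Implicit.
Unset Printing Implicit Defensive.

(* Both [arc u v] and [arc v u] may hold; only loops are excluded. *)
Record digraph (V : finType) := Digraph {
  arc :> rel V;
  arc_irr : irreflexive arc
}.

Section ZeroForcing.
Variables (V : finType) (D : digraph V).

Definition outN (v : V) : {set V} := [set u | D v u].
Definition inN (v : V) : {set V} := [set u | D u v].
Definition indeg (v : V) : nat := #|inN v|.
Definition source (v : V) : Prop := indeg v = 0.

Definition force_step (B : {set V}) : {set V} :=
  B :|: [set w | [exists v in B, outN v :\: B == [set w]]].

Definition forced (S : {set V}) (t : nat) : {set V} := iter t force_step S.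

Definition zero_forcing (S : {set V}) : Prop := exists t, forced S t = setT.

Definition failed_zero_forcing (S : {set V}) : Prop := ~ zero_forcing S.

(* For nonempty [V] the empty set is failed, so the maximum ranges over a
   nonempty family and the default value 0 of [\max] is never relied upon. *)
Definition failed_zf_number : nat :=
  \max_(S : {set V} | `[< failed_zero_forcing S >]) #|S|.

End ZeroForcing.

(* Main.v *)
Require Import Defs.
From mathcomp Require Import all_boot.
From mathcomp Require Import boolp.
Set Implicit Arguments.
Unset Strict Implicit.
Unset Printing Implicit Defensive.

(* The complement of a stalled closure is a "fort": a nonempty set [W] such that
   no vertex outside [W] has exactly one out-neighbor in [W]. A set fails to
   force iff it avoids some fort, so [F(D) = n - k] iff the smallest fort has
   [k] elements; the three conditions spell out forts of size 1, 2 and 3. *)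

Section Forts.
Variables (V : finType) (D : digraph V).
Implicit Types (S W : {set V}) (u v w x : V).

Definition fort W : Prop :=
  W != set0 /\ forall x, x \notin W -> #|outN D x :&: W| != 1.

(** The first vertex [y] of [W] to be forced would be forced by some [x] outside [W]. As [B] misses
    [W], every out-neighbor of [x] in [W] is still unforced, so [y] is the only one, which the fort
    property forbids. *)
Lemma forced_disjoint_fort W S t :
  fort W -> [disjoint S & W] -> [disjoint forced D S t & W].
Proof.
move=> [_ fW] dSW; elim: t => [|t IH] //=.
rewrite -/(forced D S t); set B := forced D S t in IH *.
rewrite /force_step -setI_eq0 setIUl setU_eq0 !setI_eq0 IH /= disjoint_subset; apply/subsetP => y.
rewrite inE => /exists_inP[x xB /eqP Ey]; apply/negP => yW.
have xW : x \notin W by rewrite (disjointFr IH).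
move: (fW _ xW); apply/negP; rewrite negbK; apply/cards1P; exists y.
apply/setP => z; move/setP/(_ z): (Ey); rewrite !inE.
case: (boolP (z \in W)) => [zW|nzW]; first by rewrite (disjointFl IH) ?andbT.
by move=> _; rewrite andbF; apply/esym/negbTE; apply: contraNneq nzW => ->.
Qed.

Lemma fort_complement_failed W : fort W -> failed_zero_forcing D (~: W).
Proof.
move=> fW [t Et]; have [/set0Pn[x xW] _] := fW.
have d : [disjoint ~: W & W] by rewrite disjoint_sym -setI_eq0 setICr.
by move: (forced_disjoint_fort t fW d); rewrite Et => /disjointFl/(_ xW); rewrite inE.
Qed.

(** Induction on the number of vertices outside [S]. If a step enlarges [S], the larger set still
    fails, and a fort avoiding it avoids [S]. If [S] is stalled, its complement is itself a fort: a
    vertex of [S] with exactly one out-neighbor outside [S] would force it. *)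
Lemma failed_disjoint_fort S :
  failed_zero_forcing D S -> exists2 W, fort W & [disjoint S & W].
Proof.
have [n] := ubnP #|~: S|; elim: n S => // n IH S ltn fS.
have [stalled|moves] := eqVneq (force_step D S) S; last first.
  have sub : S \proper force_step D S.
    by rewrite properEneq eq_sym moves subsetUl.
  have [||W fW dW] := IH (force_step D S).
  - rewrite -ltnS (leq_trans _ ltn) // ltnS; apply: proper_card; move: sub.
    by rewrite /proper !setCS.
  - by move=> [t Et]; apply: fS; exists t.+1; rewrite /forced iterSr.
  - by exists W => //; apply: disjointWl dW; apply: proper_sub.
exists (~: S); last by rewrite -setI_eq0 setICr.
(* An empty complement would make [S] all of [V], hence zero forcing at time 0. *)
split=> [|x]; first by apply/eqP => E; apply: fS; exists 0; rewrite /= -(setCK S) E setC0.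
rewrite inE negbK => xS; apply/cards1P => -[y]; rewrite -setDE => Ey.
have yS : y \in S.
  rewrite -stalled !inE; apply/orP; right.
  by apply/exists_inP; exists x => //; apply/eqP.
by move/setP/(_ y): Ey; rewrite !inE yS eqxx.
Qed.

Lemma card_le_failed_zf_number W : fort W -> #|V| <= failed_zf_number D + #|W|.
Proof.
move=> fW; rewrite -(cardsC W) addnC leq_add2r.
apply: (leq_bigmax_cond (F := fun S : {set V} => #|S|)).
exact/asboolP/fort_complement_failed.
Qed.

Lemma fort_setT : 0 < #|V| -> fort setT.
Proof. by move=> V_gt0; split=> [|x]; rewrite ?inE // -card_gt0 cardsT. Qed.

Lemma failed_zf_number_attained :
  0 < #|V| -> exists2 W, fort W & failed_zf_number D + #|W| = #|V|.
Proof.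
move=> V_gt0.
have fam : 0 < #|[pred S : {set V} | `[< failed_zero_forcing D S >]]|.
  (* The empty set, seen as the complement of the fort [setT], is failed; hence the maximum is
     attained by an actual failed set. *)
  apply/card_gt0P; exists (~: setT); rewrite inE; apply/asboolP.
  exact/fort_complement_failed/fort_setT.
have [S] := eq_bigmax_cond (fun S : {set V} => #|S|) fam.
rewrite inE => /asboolP/failed_disjoint_fort[W fW dW] ES.
exists W => //; apply/eqP; rewrite eqn_leq card_le_failed_zf_number // andbT.
rewrite -(cardsC W) [leqRHS]addnC leq_add2r.
rewrite [leqLHS](_ : _ = #|S|) //; apply: subset_leq_card.
by rewrite -disjoints_subset.
Qed.

Lemma failed_zf_numberP k : 0 < #|V| ->
  failed_zf_number D + k = #|V| <->
  (exists2 W, fort W & #|W| = k) /\ forall W, fort W -> k <= #|W|.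
Proof.
move=> V_gt0; have [W0 fW0 EW0] := failed_zf_number_attained V_gt0; split=> [E|].
  split=> [|W /card_le_failed_zf_number]; last by rewrite -E leq_add2l.
  by exists W0 => //; apply/eqP; rewrite -(eqn_add2l (failed_zf_number D)) E EW0.
move=> [[W fW <-] minW]; apply/eqP.
by rewrite eqn_leq card_le_failed_zf_number // andbT -EW0 leq_add2l minW.
Qed.

(** Over an explicit duplicate-free list the intersection size becomes a [count], which unfolds to a
    sum of booleans for forts of size 1, 2 and 3. *)
Lemma fort_seq (s : seq V) : uniq s -> 0 < size s ->
  fort [set:: s] <-> forall x, x \notin s -> count (D x) s != 1.
Proof.
move=> us s_gt0.
have E x : #|outN D x :&: [set:: s]| = count (D x) s.
  rewrite -size_filter -(card_uniqP (filter_uniq _ us)); apply: eq_card => y.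
  by rewrite !inE mem_filter.
split=> [[_ fs] x xs|fs]; first by rewrite -E fs ?inE.
split=> [|x]; last by rewrite inE E; apply: fs.
by case: s s_gt0 {us fs E} => // y s _; apply/set0Pn; exists y; rewrite !inE eqxx.
Qed.

Lemma exists_fort_seq k : 0 < k ->
  (exists2 W, fort W & #|W| = k) <->
  exists s : seq V, [/\ uniq s, size s = k
    & forall x, x \notin s -> count (D x) s != 1].
Proof.
move=> k_gt0; split=> [[W fW EW]|[s [us sk fs]]].
  exists (enum W); rewrite enum_uniq -cardE; split=> //.
  apply/fort_seq; rewrite ?enum_uniq -?cardE ?EW //.
  by rewrite (_ : [set:: _] = W) //; apply/setP => x; rewrite inE mem_enum.
exists [set:: s]; first by apply/fort_seq; rewrite ?sk.
by rewrite cardsE (card_uniqP us).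
Qed.

Lemma fort1P :
  (exists2 W, fort W & #|W| = 1) <-> exists v, source D v.
Proof.
rewrite exists_fort_seq //; split=> [[[|v[|? ?]] [// _ _ fv]]|[v /eqP]].
  exists v; apply/eqP; rewrite cards_eq0; apply/eqP/setP => x; rewrite !inE.
  have [->|xv] := eqVneq x v; first exact: arc_irr.
  by have := fv x; rewrite inE xv => /(_ isT) /=; case: (D x v).
rewrite cards_eq0 => /eqP E; exists [:: v]; split=> // x _ /=.
by move/setP/(_ x): E; rewrite !inE => ->.
Qed.

(** A vertex outside the pair must send arcs to both or to neither. The two set differences discard
    [u] and [v] themselves, using that there are no loops. *)
Lemma fort2P :
  (exists2 W, fort W & #|W| = 2) <->
  exists u v, u <> v /\ inN D u :\ v = inN D v :\ u.
Proof.
rewrite exists_fort_seq //.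
split=> [[[|u[|v[|? ?]]] [//= us _ fuv]]|[u [v [/eqP uv E]]]].
  exists u, v; split; first by apply/eqP; move: us; rewrite inE andbT.
  apply/setP => x; rewrite !inE.
  have [->|xu] := eqVneq x u; first by rewrite arc_irr andbF.
  have [->|xv] := eqVneq x v; first by rewrite arc_irr.
  have := fuv x; rewrite !inE (negbTE xu) (negbTE xv) => /(_ isT).
  by case: (D x u); case: (D x v).
exists [:: u; v]; split=> //=; first by rewrite inE uv.
move=> x; rewrite !inE negb_or => /andP[xu xv].
by move/setP/(_ x): E; rewrite !inE xu xv /= => ->; case: (D x v).
Qed.

(** The only forbidden count is 1, so an outside vertex with an arc to one of the three must have an
    arc to another; each inclusion says this for one choice of the first. *)
Lemma fort3P :
  (exists2 W, fort W & #|W| = 3) <->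
  exists u v w,
    [/\ u <> v, u <> w & v <> w] /\
    [/\ inN D u :\: [set v; w] \subset inN D v :|: inN D w,
        inN D v :\: [set u; w] \subset inN D u :|: inN D w
      & inN D w :\: [set u; v] \subset inN D u :|: inN D v].
Proof.
rewrite exists_fort_seq //.
split=> [[[|u[|v[|w[|? ?]]]] [//= us _ f]]|]; last first.
  move=> [u [v [w [[/eqP uv /eqP uw /eqP vw] [/subsetP su /subsetP sv /subsetP sw]]]]].
  exists [:: u; v; w]; split=> //=; first by rewrite !inE negb_or uv uw vw.
  move=> x; rewrite !inE !negb_or => /and3P[xu xv xw].
  move: (su x) (sv x) (sw x).
  rewrite !inE (negbTE xu) (negbTE xv) (negbTE xw) /=.
  (* Three cases survive, with a single arc into the triple; each contradicts the inclusion for the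
     head of that arc. *)
  case: (D x u); case: (D x v); case: (D x w) => //=;
    by [move=> /(_ isT) | move=> _ /(_ isT) | move=> _ _ /(_ isT)].
exists u, v, w; split.
  by move: us; rewrite !inE negb_or andbT => /andP[/andP[/eqP uv /eqP uw] /eqP vw].
have H x : x != u -> x != v -> x != w -> D x u + (D x v + (D x w + 0)) != 1.
  by move=> xu xv xw; apply: f; rewrite !inE !negb_or xu xv.
(* Each inclusion removes only two of the three vertices; the absence of loops excludes the
   third. *)
have out x y : D x y -> x != y by apply: contraTneq => ->; rewrite arc_irr.
split; apply/subsetP => x; rewrite !inE negb_or => /andP[/andP[n1 n2] a].
- by have := H x (out _ _ a) n1 n2; rewrite a; case: (D x v); case: (D x w).
- by have := H x n1 (out _ _ a) n2; rewrite a; case: (D x u); case: (D x w).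
- by have := H x n1 n2 (out _ _ a); rewrite a; case: (D x u); case: (D x v).
Qed.

(** Minimality is unfolded into one negation per smaller size, to match the negated conditions of
    the theorem. Size 0 is left out because forts are nonempty. *)
Lemma failed_zf_numberS k : 0 < #|V| ->
  failed_zf_number D + k.+1 = #|V| <->
  (exists2 W, fort W & #|W| = k.+1) /\
  forall j, 0 < j <= k -> ~ exists2 W, fort W & #|W| = j.
Proof.
move=> V_gt0; rewrite failed_zf_numberP //; split=> -[ex mn]; split=> //.
  by move=> j /andP[_ jk] [W /mn + Wj]; rewrite Wj leqNgt ltnS jk.
move=> W fW; rewrite ltnNge; apply/negP => Wk.
by apply: (mn #|W|); [rewrite Wk andbT card_gt0; case: fW | exists W].
Qed.

Lemma no_sourceP : ~ (exists v, source D v) <-> forall v, 0 < indeg D v.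
Proof.
split=> [ns v|pos [v s0]]; last by have := pos v; rewrite s0.
by rewrite lt0n; apply/eqP => s0; apply: ns; exists v.
Qed.

End Forts.

(* [F(D) = n - k] is written [F(D) + k = n]: truncated subtraction on [nat]
   would make [F(D) = n - k] wrong for small [n]. *)
Theorem corollary2p3 (V : finType) (D : digraph V) (V_gt0 : 0 < #|V|) :
  (failed_zf_number D + 1 = #|V| <-> exists v : V, source D v)
  /\
  (failed_zf_number D + 2 = #|V| <->
     (exists u v : V, u <> v /\ inN D u :\ v = inN D v :\ u) /\
     (forall w : V, 0 < indeg D w))
  /\
  (failed_zf_number D + 3 = #|V| <->
     [/\ forall v : V, 0 < indeg D v,
         forall u v : V, u <> v -> inN D u :\ v <> inN D v :\ u
       & exists u v w : V,
           [/\ u <> v, u <> w & v <> w] /\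
           [/\ inN D u :\: [set v; w] \subset inN D v :|: inN D w,
               inN D v :\: [set u; w] \subset inN D u :|: inN D w
             & inN D w :\: [set u; v] \subset inN D u :|: inN D v]]).
Proof.
split; last split; rewrite failed_zf_numberS //.
(* Here the range of smaller sizes is empty; in the next two parts it is 1, then 1 and 2. *)
- by rewrite fort1P; split=> [[]|s] //; split=> // -[].
- rewrite fort2P -no_sourceP -fort1P; split=> -[ex no]; split=> //.
    exact: no.
  by case=> [|[|j]].
- rewrite fort3P; split=> [[ex no]|[/no_sourceP no1 no2 ex]].
    split=> //; first by apply/no_sourceP; rewrite -fort1P; apply: no.
    by move=> u v uv E; apply: (no 2) => //; apply/fort2P; exists u, v.
  split=> // -[|[|[|j]]] // _; first by rewrite fort1P.
  by move=> /fort2P[u [v [uv E]]]; apply: no2 uv E.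
Qed.
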